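(* Let $K$ be a field and $K\langle X\rangle=K\langle X_1,\ldots,X_n\rangle$ the free $K$-algebra on $X=\{X_1,\ldots,X_n\}$, equipped with a weight $\mathbb{N}$-gradation, and let $\prec$ be a monomial ordering on the set $\mathcal{B}$ of all monomials (words) of $K\langle X\rangle$. Let $\mathcal{G}=\{g_1,\ldots,g_s\}$ be a finite homogeneous Gröbner basis, with respect to $\prec$, for the ideal $I=\langle\mathcal{G}\rangle$ of $K\langle X\rangle$, such that $\mathbf{LM}(\mathcal{G})\cap X=\emptyset$ and $\mathbf{LM}(\mathcal{G})$ is reduced. If the monomial algebra $\overline{A}=K\langle X\rangle/\langle\mathbf{LM}(\mathcal{G})\rangle$ is semi-prime, then the $\mathbb{N}$-graded algebra $A=K\langle X\rangle/I$ is semiprimitive.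
   Context: $\mathbb{N}$ is the set of nonnegative integers. Algebras are associative $K$-algebras with identity $1$, ideals are two-sided, and $\langle U\rangle$ denotes the two-sided ideal generated by a subset $U$. $\mathcal{B}$ denotes the standard $K$-basis of $K\langle X\rangle$ consisting of all monomials (words) in the $X_i$, including $1$. Weight $\mathbb{N}$-gradation: each $X_i$ is assigned a positive integer degree $m_i$, the degree of a word is the sum of the degrees of its letters, and $K\langle X\rangle=\bigoplus_{p\in\mathbb{N}}K\langle X\rangle_p$, where $K\langle X\rangle_p$ is the $K$-span of all words of degree $p$. ''Homogeneous'' refers to this gradation. If $I$ is generated by homogeneous elements, $A=K\langle X\rangle/I$ is $\mathbb{N}$-graded with $A_p=(K\langle X\rangle_p+I)/I$. Monomial ordering: a well-ordering $\prec$ on $\mathcal{B}$ such that, for all $w,u,v,s\in\mathcal{B}$, $u\prec v$ implies $wus\prec wvs$, and $v=wus$ with $w\neq 1$ or $s\neq 1$ implies $u\prec v$. Leading monomials: for nonzero $f=\sum_{i=1}^s\lambda_iw_i$ with $\lambda_i\in K\setminus\{0\}$ and $w_1\prec\cdots\prec w_s$ in $\mathcal{B}$, $\mathbf{LM}(f)=w_s$. For $S\subseteq K\langle X\rangle$, $\mathbf{LM}(S)$ is the set of leading monomials of the nonzero elements of $S$. Gröbner basis: a subset $\mathcal{G}\subseteq I\setminus\{0\}$ is a Gröbner basis of the ideal $I$ (with respect to $\prec$) if $\langle\mathbf{LM}(I)\rangle=\langle\mathbf{LM}(\mathcal{G})\rangle$. It is a homogeneous Gröbner basis if all its elements are homogeneous.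 Reduced: for $u,v\in\mathcal{B}$, $v$ divides $u$ if $u=wvs$ for some $w,s\in\mathcal{B}$. A subset $\Omega\subseteq\mathcal{B}$ is reduced if for all $u,v\in\Omega$ with $u\neq v$, $v$ does not divide $u$. An algebra $R$ is semi-prime if $a\in R$ and $aRa=\{0\}$ imply $a=0$. It is semiprimitive if its Jacobson radical is $J(R)=\{0\}$. *)

(* Defs.v *)
From HB Require Import structures.
From mathcomp Require Import all_boot all_order all_algebra.
From mathcomp Require Import finmap generic_quotient ring_quotient.
From mathcomp Require Import boolp classical_sets cardinality.
From mathcomp Require Export monalg.

Set Implicit Arguments.
Unset Strict Implicit.
Unset Printing Implicit Defensive.

Import GRing.Theory.
Local Open Scope ring_scope.
Local Open Scope classical_set_scope.
Local Open Scope quotient_scope.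

(* pzRingType is used throughout because a quotient may be the zero ring. *)
Section Ideals.
Variable R : pzRingType.
Implicit Types (I M U : set R).

Definition left_ideal I :=
  [/\ I 0, (forall x y, I x -> I y -> I (x + y))
    & (forall a x, I x -> I (a * x))].

Definition two_sided_ideal I :=
  left_ideal I /\ (forall a x, I x -> I (x * a)).

Definition ideal_gen U : set R := smallest two_sided_ideal U.

Definition maximal_left_ideal M :=
  [/\ left_ideal M, M <> setT
    & forall I, left_ideal I -> M `<=` I -> I = M \/ I = setT].

Definition jacobson_radical : set R :=
  \bigcap_(M in maximal_left_ideal) M.

Definition semiprimitive := jacobson_radical = [set 0].

Definition semi_prime := forall a : R, (forall r, a * r * a = 0) -> a = 0.

Lemma two_sided_ideal_gen U : two_sided_ideal (ideal_gen U).
Proof.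
split; first split.
- by move=> I [[[]]].
- move=> x y Ix Iy I [idI UI]; have [[_ ID _] _] := idI.
  by apply: ID; [apply: Ix | apply: Iy].
- move=> a x Ix I [idI UI]; have [[_ _ IM] _] := idI.
  by apply: IM; apply: Ix.
- move=> a x Ix I [idI UI]; have [_ IM] := idI.
  by apply: IM; apply: Ix.
Qed.

Lemma sub_ideal_gen U : U `<=` ideal_gen U.
Proof. by move=> x Ux I [_]; apply. Qed.

End Ideals.

Arguments jacobson_radical R : clear implicits.
Arguments semiprimitive R : clear implicits.
Arguments semi_prime R : clear implicits.

(* ring_quotient only makes R / I a ring when R is commutative, so its additive
   quotient is reused here and given the multiplication induced from R. *)
Section QuotientRing.
Variables (R : pzRingType) (U : set R).

Definition in_ideal_gen : R -> bool := fun x => `[< ideal_gen U x >].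

Lemma in_ideal_genP x : reflect (ideal_gen U x) (x \in in_ideal_gen).
Proof. exact: asboolP. Qed.

Fact in_ideal_gen_zmod_closed : zmod_closed in_ideal_gen.
Proof.
have [[I0 ID IMl] _] := two_sided_ideal_gen U.
split; first exact/in_ideal_genP.
move=> x y /in_ideal_genP Ix /in_ideal_genP Iy; apply/in_ideal_genP.
by apply: ID => //; rewrite -mulN1r; apply: IMl.
Qed.

HB.instance Definition _ :=
  GRing.isZmodClosed.Build R in_ideal_gen in_ideal_gen_zmod_closed.

Definition quot_ideal :=
  @Quotient.quot R (GRing.ZmodClosed.clone R in_ideal_gen _).

HB.instance Definition _ := GRing.Zmodule.on quot_ideal.
HB.instance Definition _ := Quotient.on quot_ideal.

Definition quot_proj : R -> quot_ideal := \pi_quot_ideal.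

Lemma quot_projK : cancel (@repr _ quot_ideal) quot_proj.
Proof. exact: reprK. Qed.

Lemma quot_proj_eqP x y :
  quot_proj x = quot_proj y <-> ideal_gen U (x - y).
Proof.
split=> [/eqP|/in_ideal_genP].
  by rewrite -Quotient.idealrBE => /in_ideal_genP.
by rewrite Quotient.idealrBE => /eqP.
Qed.

Lemma quot_proj_is_zmod_morphism : zmod_morphism quot_proj.
Proof. exact: pi_is_zmod_morphism. Qed.

Definition quot_one : quot_ideal := quot_proj 1.
Definition quot_mul (x y : quot_ideal) : quot_ideal :=
  quot_proj (repr x * repr y).

Lemma quot_projM x y : quot_proj (x * y) = quot_mul (quot_proj x) (quot_proj y).
Proof.
have [[_ ID IMl] IMr] := two_sided_ideal_gen U.
set x' := repr (quot_proj x); set y' := repr (quot_proj y).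
have Ix : ideal_gen U (x - x') by apply/quot_proj_eqP; rewrite quot_projK.
have Iy : ideal_gen U (y - y') by apply/quot_proj_eqP; rewrite quot_projK.
apply/quot_proj_eqP; rewrite -/x' -/y'.
have -> : x * y - x' * y' = (x - x') * y + x' * (y - y').
  by rewrite mulrBl mulrBr addrA subrK.
by apply: ID; [apply: IMr | apply: IMl].
Qed.

Fact quot_mulA : associative quot_mul.
Proof.
move=> x y z; rewrite -[x]quot_projK -[y]quot_projK -[z]quot_projK.
by rewrite -!quot_projM mulrA.
Qed.

Fact quot_mul1q : left_id quot_one quot_mul.
Proof. by move=> x; rewrite -[x]quot_projK -quot_projM mul1r. Qed.

Fact quot_mulq1 : right_id quot_one quot_mul.
Proof. by move=> x; rewrite -[x]quot_projK -quot_projM mulr1. Qed.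

Lemma quot_projD x y : quot_proj (x + y) = quot_proj x + quot_proj y.
Proof. by rewrite /quot_proj !piE. Qed.

Fact quot_mulDl : left_distributive quot_mul +%R.
Proof.
move=> x y z; rewrite -[x]quot_projK -[y]quot_projK -[z]quot_projK.
by rewrite -quot_projD -!quot_projM mulrDl quot_projD.
Qed.

Fact quot_mulDr : right_distributive quot_mul +%R.
Proof.
move=> x y z; rewrite -[x]quot_projK -[y]quot_projK -[z]quot_projK.
by rewrite -quot_projD -!quot_projM mulrDr quot_projD.
Qed.

HB.instance Definition _ := GRing.Zmodule_isPzRing.Build quot_ideal
  quot_mulA quot_mul1q quot_mulq1 quot_mulDl quot_mulDr.

HB.instance Definition _ :=
  GRing.isZmodMorphism.Build R quot_ideal quot_proj quot_proj_is_zmod_morphism.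

Fact quot_proj_is_monoid_morphism : monoid_morphism quot_proj.
Proof. by split=> // x y; rewrite quot_projM. Qed.

HB.instance Definition _ :=
  GRing.isMonoidMorphism.Build R quot_ideal quot_proj
    quot_proj_is_monoid_morphism.

End QuotientRing.

(* {fmonom 'I_n} is the free monoid of words in the letters X_i = fmu i. *)
Notation words n := {fmonom 'I_n}.
Notation free_alg K n := {malg K[{fmonom 'I_n}]}.

Section Words.
Variable n : nat.
Implicit Types (u v w s : words n).

Definition letters : set (words n) := range (@fmu 'I_n).

Definition divides v u := exists w s, u = mmul (mmul w v) s.

Definition reduced (O : set (words n)) :=
  forall u v, O u -> O v -> u <> v -> ~ divides v u.

Definition wdeg (m : 'I_n -> nat) w : nat := \sum_(i <- (w : seq 'I_n)) m i.

Record monomial_ordering (prec : rel (words n)) : Prop := MonomialOrdering {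
  mord_irr : irreflexive prec;
  mord_trans : transitive prec;
  mord_total : forall u v, u <> v -> prec u v \/ prec v u;
  mord_wf : well_founded prec;
  mord_compat : forall w u v s,
    prec u v -> prec (mmul (mmul w u) s) (mmul (mmul w v) s);
  mord_factor : forall w u v s,
    v = mmul (mmul w u) s -> w <> mone \/ s <> mone -> prec u v
}.

End Words.

Section FreeAlgebra.
Variables (K : fieldType) (n : nat).
Implicit Types (f g : free_alg K n) (S G I : set (free_alg K n)).

Definition homogeneous_of_degree (m : 'I_n -> nat) (p : nat) f :=
  forall w, w \in msupp f -> wdeg m w = p.

Definition homogeneous m f := exists p, homogeneous_of_degree m p f.

(* w = LM(f); there is no such w when f = 0. *)
Definition leading_monomial (prec : rel (words n)) f w :=
  w \in msupp f /\ (forall v, v \in msupp f -> v <> w -> prec v w).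

Definition LM (prec : rel (words n)) S : set (words n) :=
  [set w | exists2 f, S f & leading_monomial prec f w].

Definition monomials (O : set (words n)) : set (free_alg K n) :=
  [set << w >> | w in O].

Definition groebner_basis (prec : rel (words n)) G I :=
  G `<=` I `\ 0 /\
  ideal_gen (monomials (LM prec I)) = ideal_gen (monomials (LM prec G)).

End FreeAlgebra.

Arguments letters n : clear implicits.
Arguments monomials K {n} O.

Section LeadingMonomial.
Variables (K : fieldType) (n : nat) (prec : rel (words n)).
Hypothesis ordP : monomial_ordering prec.

Lemma leading_monomial_exists (f : free_alg K n) :
  f != 0 -> exists w, leading_monomial prec f w.
Proof.
rewrite -msupp_eq0 /leading_monomial.
have : forall s : seq (words n), s != [::] ->
    exists w, w \in s /\ (forall v, v \in s -> v <> w -> prec v w).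
  elim=> // u [|u' s] IH _.
    by exists u; rewrite mem_seq1; split=> // v; rewrite mem_seq1 => /eqP.
  have [//|w [ws wmax]] := IH; have [->|/eqP uw] := eqVneq u w.
    exists w; rewrite mem_head; split=> // v; rewrite inE.
    by case/orP=> [/eqP //|]; apply: wmax.
  have [pwu|puw] := mord_total ordP uw.
    exists w; rewrite in_cons ws orbT; split=> // v.
    by rewrite in_cons => /orP[/eqP->|/wmax].
  exists u; rewrite mem_head; split=> // v; rewrite in_cons.
  case/orP=> [/eqP //|vs _]; have [->//|/eqP vw] := eqVneq v w.
  exact: mord_trans ordP _ _ _ (wmax _ vs vw) puw.
move=> ex fn0; have [|w wP] := ex (msupp f); last by exists w.
apply: contraNneq fn0 => s0; apply/eqP/fsetP => k.
rewrite in_fset0; apply/negP => kf.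
by have : k \in enum_fset (msupp f) by []; rewrite s0.
Qed.

Lemma leading_monomial_uniq (f : free_alg K n) w w' :
  leading_monomial prec f w -> leading_monomial prec f w' -> w = w'.
Proof.
move=> [wf wmax] [wf' wmax']; apply/eqP; apply: contraT => /eqP ww'.
have := mord_trans ordP (wmax' _ wf ww') (wmax _ wf' (nesym ww')).
by rewrite (mord_irr ordP).
Qed.

End LeadingMonomial.

(* Main.v *)
Require Import Defs.
From HB Require Import structures.
From mathcomp Require Import all_boot all_order all_algebra.
From mathcomp Require Import finmap.
From mathcomp Require Import boolp classical_sets cardinality.

(** Call a word admissible if no element of [LM(G)] divides it. The proof shows
    that the radical of [A] is zero by reducing to its homogeneous elements.

    A homogeneous element [x] of [A], nonzero, can be represented with an
    admissible leading monomial [u] ([leading_monomial_reduction]). If [u] is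
    not empty, semi-primeness of the monomial algebra says that every
    admissible [v] extends to an admissible [v w v]; as the elements of [LM(G)]
    have bounded length, iterating this gives a word [b] such that all powers
    of [u b] are admissible ([avoids_wpow]). By the Groebner basis property the
    powers of [x b], with leading monomials [(u b)^k], are nonzero in [A]. But
    a homogeneous element [h] of positive degree in the radical is nilpotent,
    since an inverse of [1 - h] must be the geometric series
    ([quasi_inverse_nilpotent]). So [x] is not in the radical
    ([homogeneous_avoids_notin_jacobson_radical]).

    It remains to see that the radical contains a nonzero homogeneous element
    as soon as it is nonzero, which is Bergman's theorem that the radical of a
    graded ring is homogeneous. Over an infinite field one would apply the
    automorphisms multiplying the degree [i] part by [c^i] and invert a
    Vandermonde matrix. For an arbitrary field the scalars are replaced by the
    elements of a group of large prime order [p], nonzero in [K]: the radical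
    of [A] stays radical in the group algebra of [Z/p] over [A]
    ([jacobson_radical_group_algebra]), which has the automorphisms
    [a |-> a t^(j i)], [a] of degree [i], and averaging over [j] isolates [p]
    times a single component ([jacobson_radical_component]). *)

Set Implicit Arguments.
Unset Strict Implicit.
Unset Printing Implicit Defensive.

Import GRing.Theory.
Local Open Scope ring_scope.
Local Open Scope classical_set_scope.

(** * The Jacobson radical *)

Section Jacobson.
Variable R : pzRingType.
Implicit Types (I N M : set R) (a b x : R).

Lemma left_ideal_jacobson_radical : left_ideal (jacobson_radical R).
Proof.
split=> [M [[]] // | x y Jx Jy M maxM | a x Jx M maxM].
  by have [[_ ID _] _ _] := maxM; apply: ID; [apply: Jx | apply: Jy].
by have [[_ _ IM] _ _] := maxM; apply: IM; apply: Jx.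
Qed.

(** Zorn's lemma on the left ideals above [N] that miss [1]. The empty set is
    thrown in so that the union of an empty chain stays in the family. *)
Lemma maximal_left_ideal_exists N :
  left_ideal N -> ~ N 1 -> exists2 M, maximal_left_ideal M & N `<=` M.
Proof.
move=> idN N1; pose P X := X = set0 \/ [/\ left_ideal X, N `<=` X & ~ X 1].
have properP I : left_ideal I -> I 1 -> I = setT.
  move=> [_ _ IM] I1; apply/seteqP; split=> // x _.
  by rewrite -[x]mulr1; apply: IM.
have [|M [PM maxM]] := @Zorn_bigcup _ P.
  move=> F FP totF.
  have [[X0 FX0 [z X0z]]|noX] := pselect (exists2 X, F X & X !=set0);
    last first.
    left; apply/seteqP; split=> // x [X FX Xx].
    by case: noX; exists X => //; exists x.
  have good X x : F X -> X x -> [/\ left_ideal X, N `<=` X & ~ X 1].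
    by move=> /FP[-> //|].
  have [[X00 _ _] NX0 _] := good _ _ FX0 X0z.
  right; split; last by case=> X FX X1; have [_ _] := good _ _ FX X1.
  - split; first by exists X0.
    + move=> x y [X FX Xx] [Y FY Yy].
      have [XY|YX] := totF _ _ FX FY.
        exists Y => //; have [[_ ID _] _ _] := good _ _ FY Yy.
        by apply: ID => //; apply: XY.
      exists X => //; have [[_ ID _] _ _] := good _ _ FX Xx.
      by apply: ID => //; apply: YX.
    + move=> a x [X FX Xx]; exists X => //.
      by have [[_ _ IM] _ _] := good _ _ FX Xx; apply: IM.
  - by move=> x /NX0 X0x; exists X0.
case: PM => [M0|[idM NM M1]].
  case: (maxM N); last by right; split.
  have [N0 _ _] := idN; rewrite M0; split=> [|/(_ 0 N0)//].
  by move=> x [].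
exists M => //; split=> // [MT|I idI MI]; first by apply: M1; rewrite MT.
have [I1|I1] := pselect (I 1); first by right; apply: properP.
left; apply/seteqP; split=> //; apply: contrapT => IM.
by case: (maxM I); [split | right; split=> //; apply: subset_trans MI].
Qed.

Lemma jacobson_left_inverse x :
  jacobson_radical R x -> exists u, u * (1 - x) = 1.
Proof.
move=> Jx; apply: contrapT => noU.
pose N := range (fun u => u * (1 - x)).
have [|[u _ u1]|M maxM NM] := @maximal_left_ideal_exists N.
- split; first by exists 0; rewrite ?mul0r.
    by move=> _ _ [u _ <-] [v _ <-]; exists (u + v); rewrite ?mulrDl.
  by move=> a _ [u _ <-]; exists (a * u); rewrite ?mulrA.
- by apply: noU; exists u.
have [[M0 MD MM] MT _] := maxM; apply: MT.
have M1 : M 1.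
  rewrite -[1](subrK x); apply: MD; last exact: Jx.
  by apply: NM; exists 1; rewrite ?mul1r.
by apply/seteqP; split=> // y _; rewrite -[y]mulr1; apply: MM.
Qed.

(** Quasi-regularity: if [x] misses a maximal left ideal [M], then [1 - a x]
    lies in [M] for some [a], so it has no left inverse. *)
Lemma jacobson_radicalP x :
  jacobson_radical R x <-> forall a, exists u, u * (1 - a * x) = 1.
Proof.
have [_ _ JM] := left_ideal_jacobson_radical.
split=> [Jx a|invx M maxM].
  by apply: jacobson_left_inverse; apply: JM.
have [[M0 MD MM] MT maxiM] := maxM; apply: contrapT => Mx.
pose I := [set y | exists a, M (y - a * x)].
have idI : left_ideal I.
  split; first by exists 0; rewrite mul0r subrr.
  - move=> y z [a My] [b Mz]; exists (a + b).
    by rewrite mulrDl opprD addrACA; apply: MD.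
  - by move=> b y [a My]; exists (b * a); rewrite -mulrA -mulrBr; apply: MM.
have MI : M `<=` I by move=> y My; exists 0; rewrite mul0r subr0.
have [IM|IT] := maxiM I idI MI.
  by apply: Mx; rewrite -IM; exists 1; rewrite mul1r subrr.
have [a Ma] : I 1 by rewrite IT.
have [u u1] := invx a; apply: MT; apply/seteqP; split=> // y _.
by rewrite -[y]mulr1 -u1; apply: (MM); apply: MM.
Qed.

(** If [u] is a left inverse of [1 - b a x], then [1 + a x u b] is one of
    [1 - a x b]: this turns the left-handed radical into a two-sided ideal. *)
Lemma jacobson_radicalMr x b :
  jacobson_radical R x -> jacobson_radical R (x * b).
Proof.
move=> /jacobson_radicalP invx; apply/jacobson_radicalP => a.
have [u u1] := invx (b * a); exists (1 + a * x * u * b).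
have -> : (1 + a * x * u * b) * (1 - a * (x * b))
    = 1 - a * x * b + a * x * (u * (1 - b * a * x)) * b.
  rewrite mulrDl mul1r mulrA; congr (_ + _).
  by rewrite !(mulrBr, mulrBl) !mulr1 !mulrA.
by rewrite u1 mulr1 subrK.
Qed.

Lemma jacobson_radicalMl x a :
  jacobson_radical R x -> jacobson_radical R (a * x).
Proof. by have [_ _] := left_ideal_jacobson_radical; apply. Qed.

Lemma jacobson_radicalD x y :
  jacobson_radical R x -> jacobson_radical R y -> jacobson_radical R (x + y).
Proof. by have [_ + _] := left_ideal_jacobson_radical; apply. Qed.

Lemma jacobson_radical0 : jacobson_radical R 0.
Proof. by have [] := left_ideal_jacobson_radical. Qed.

Lemma jacobson_radicalB x y :
  jacobson_radical R x -> jacobson_radical R y -> jacobson_radical R (x - y).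
Proof.
move=> Jx Jy; apply: jacobson_radicalD => //; rewrite -mulN1r.
exact: jacobson_radicalMl.
Qed.

End Jacobson.

(** A surjective multiplicative map preserves [1], hence left inverses. *)
Lemma jacobson_radical_surj_rmorph (R R' : pzRingType) (f : R -> R') x :
    {morph f : a b / a - b} -> {morph f : a b / a * b} ->
    (forall b, exists a, f a = b) ->
  jacobson_radical R x -> jacobson_radical R' (f x).
Proof.
move=> fB fM fsurj /jacobson_radicalP invx; apply/jacobson_radicalP => b.
have f1 : f 1 = 1.
  by have [e fe] := fsurj 1; rewrite -[LHS]mulr1 -fe -fM mul1r.
have [a <-] := fsurj b; have [u u1] := invx a.
by exists (f u); rewrite -f1 -fM -fB -fM u1.
Qed.

(** * The radical of the group algebra of a finite abelian group *)

(** A named copy of the function type, whose canonical product is pointwise: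
    here the product is the convolution. *)
Definition group_algebra (T : finZmodType) (R : pzRingType) := {ffun T -> R}.

Section GroupAlgebra.
Variables (T : finZmodType) (R : pzRingType).
Local Notation S := (group_algebra T R).
Implicit Types (x y z : S) (r : R) (t k : T).

HB.instance Definition _ := GRing.Zmodule.on S.

Lemma gaDE x y k : (x + y) k = x k + y k.
Proof. by rewrite ffunE. Qed.

Lemma gaBE x y k : (x - y) k = x k - y k.
Proof. by rewrite !ffunE. Qed.

Lemma ga0E k : (0 : S) k = 0.
Proof. by rewrite ffunE. Qed.

Definition gmon t r : S := [ffun k => if k == t then r else 0].
Definition gmul x y : S := [ffun k => \sum_i x i * y (k - i)].

Lemma gmulE x y k : gmul x y k = \sum_i x i * y (k - i).
Proof. by rewrite ffunE. Qed.

Fact gmulA : associative gmul.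
Proof.
move=> x y z; apply/ffunP=> k; rewrite !gmulE.
under eq_bigr do rewrite gmulE mulr_sumr.
under [RHS]eq_bigr do rewrite gmulE mulr_suml.
rewrite [RHS]exchange_big /=; apply: eq_bigr => j _.
rewrite [RHS](reindex_inj (addIr j)) /=; apply: eq_bigr => i _.
by rewrite addrK mulrA opprD (addrC (- i)) addrA.
Qed.

Fact gmon_gmul t r x k : gmul (gmon t r) x k = r * x (k - t).
Proof.
rewrite gmulE (bigD1 t) //= ffunE eqxx big1 ?addr0 // => i ne_it.
by rewrite ffunE (negPf ne_it) mul0r.
Qed.

Fact gmul_gmon t r x k : gmul x (gmon t r) k = x (k - t) * r.
Proof.
rewrite gmulE (bigD1 (k - t)) //= ffunE subKr eqxx big1 ?addr0 // => i ne_it.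
by rewrite ffunE subr_eq addrC -subr_eq eq_sym (negPf ne_it) mulr0.
Qed.

Fact gmul1x : left_id (gmon 0 1) gmul.
Proof. by move=> x; apply/ffunP => k; rewrite gmon_gmul subr0 mul1r. Qed.

Fact gmulx1 : right_id (gmon 0 1) gmul.
Proof. by move=> x; apply/ffunP => k; rewrite gmul_gmon subr0 mulr1. Qed.

Fact gmulDl : left_distributive gmul +%R.
Proof.
move=> x y z; apply/ffunP => k; rewrite gaDE !gmulE -big_split /=.
by apply: eq_bigr => i _; rewrite gaDE mulrDl.
Qed.

Fact gmulDr : right_distributive gmul +%R.
Proof.
move=> x y z; apply/ffunP => k; rewrite gaDE !gmulE -big_split /=.
by apply: eq_bigr => i _; rewrite gaDE mulrDr.
Qed.

HB.instance Definition _ := GRing.Zmodule_isPzRing.Build S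
  gmulA gmul1x gmulx1 gmulDl gmulDr.

Lemma gaME x y k : (x * y) k = \sum_i x i * y (k - i).
Proof. exact: gmulE. Qed.

Lemma gmonM t r x k : (gmon t r * x) k = r * x (k - t).
Proof. exact: gmon_gmul. Qed.

Lemma gMmon t r x k : (x * gmon t r) k = x (k - t) * r.
Proof. exact: gmul_gmon. Qed.

Lemma ga1E k : (1 : S) k = if k == 0 then 1 else 0.
Proof. by rewrite ffunE. Qed.

Lemma gmonE t r k : gmon t r k = if k == t then r else 0.
Proof. by rewrite ffunE. Qed.

(** Nakayama's lemma for the free module of finite rank [R[T]], by Gaussian
    elimination: the pivots [1 - c], with [c] in the radical, are left
    invertible, so the error terms can be cancelled one coordinate at a time. *)
Lemma nakayama_group_algebra (N : set S) : left_ideal N ->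
    (forall t, exists2 n,
       N n & forall k, jacobson_radical R ((gmon t 1 - n) k)) ->
  forall t, N (gmon t 1).
Proof.
move=> [N0 ND NM] genN.
suff elim (s : seq T) : forall t, exists n, [/\ N n,
    forall k, jacobson_radical R ((gmon t 1 - n) k)
    & forall k, k \in s -> (gmon t 1 - n) k = 0].
  move=> t; have [n [Nn _ n0]] := elim (enum T) t.
  suff -> : gmon t 1 = n by [].
  apply/eqP; rewrite -subr_eq0; apply/eqP/ffunP => k.
  by rewrite n0 ?mem_enum // ga0E.
elim: s => [|k s IHs] t; first by have [n Nn Jn] := genN t; exists n.
have [nk [Nk Jk k0]] := IHs k; have [n [Nn Jn n0]] := IHs t.
have [u u1] := jacobson_left_inverse (Jk k).
(* Coordinate [k] has error [d]; the pivot row [nk] is used to remove it. *)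
pose d := (gmon t 1 - n) k.
exists (n + gmon 0 (d * u) * nk).
have E i : (gmon t 1 - (n + gmon 0 (d * u) * nk)) i
    = (gmon t 1 - n) i
      - d * u * ((if i == k then 1 else 0) - (gmon k 1 - nk) i).
  rewrite opprD addrA [LHS]gaBE gmonM subr0 [(gmon k 1 - nk) i]gaBE gmonE.
  by rewrite subKr.
have Ek : (gmon t 1 - (n + gmon 0 (d * u) * nk)) k = 0.
  by rewrite E eqxx -mulrA u1 mulr1 subrr.
split=> [|i|i]; first by apply: ND => //; apply: NM.
  have [->|ne_ik] := eqVneq i k; first by rewrite Ek; apply: jacobson_radical0.
  rewrite E (negPf ne_ik); apply: jacobson_radicalB => //.
  apply: jacobson_radicalMl; rewrite sub0r -sub0r.
  by apply: jacobson_radicalB => //; apply: jacobson_radical0.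
rewrite inE => /orP[/eqP->//|si].
have [->|ne_ik] := eqVneq i k; first by rewrite Ek.
by rewrite E (negPf ne_ik) n0 // k0 // subrr mulr0 subrr.
Qed.

(** The left ideal generated by [1 - a r] contains each basis vector up to the
    radical of [R], because [r] commutes with the group. *)
Lemma jacobson_radical_group_algebra r :
  jacobson_radical R r -> jacobson_radical S (gmon 0 r).
Proof.
move=> Jr; apply/jacobson_radicalP => a.
pose N := range (fun u : S => u * (1 - a * gmon 0 r)).
have idN : left_ideal N.
  split; first by exists 0; rewrite ?mul0r.
    by move=> _ _ [u _ <-] [v _ <-]; exists (u + v); rewrite ?mulrDl.
  by move=> b _ [u _ <-]; exists (b * u); rewrite ?mulrA.
have [t|u _ u1] := nakayama_group_algebra idN _ (0 : T); last by exists u.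
exists (gmon t 1 * (1 - a * gmon 0 r)); first by exists (gmon t 1).
move=> k; rewrite mulrBr mulr1 subKr mulrA gMmon subr0.
exact: jacobson_radicalMl.
Qed.

End GroupAlgebra.

(** * Homogeneous components of the radical *)

Record is_grading (T : finZmodType) (R : pzRingType) (c : T -> R -> R) : Prop :=
  IsGrading {
    gradeB : forall i, {morph c i : x y / x - y};
    grade_sum : forall x, \sum_i c i x = x;
    grade_comp : forall i j x, c i (c j x) = if i == j then c i x else 0;
    gradeM : forall i x y, c i (x * y) = \sum_h c h x * c (i - h) y
  }.

Section Bergman.
Variables (F : finFieldType) (R : pzRingType) (c : F -> R -> R).
Hypothesis gr : is_grading c.
Local Notation S := (group_algebra F R).
Implicit Types (x y : S) (i j k l : F).

Let c0 i : c i 0 = 0. Proof. by have := gradeB gr i 0 0; rewrite !subrr. Qed.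
Let cN i : {morph c i : x / - x}.
Proof. by move=> x; rewrite -sub0r (gradeB gr) c0 sub0r. Qed.
Let cD i : {morph c i : x y / x + y}.
Proof. by move=> x y; rewrite -[y]opprK (gradeB gr) !cN. Qed.
Let cSum i (r : F -> R) : c i (\sum_h r h) = \sum_h c i (r h).
Proof. exact: (big_morph (c i) (cD i) (c0 i)). Qed.

(** The endomorphism of [R[F]] that fixes the group and sends a homogeneous
    [r] of degree [i] to [r t^(j i)]. *)
Definition twist j x : S := [ffun k => \sum_i c i (x (k - j * i))].

Lemma twistE j x k : twist j x k = \sum_i c i (x (k - j * i)).
Proof. by rewrite ffunE. Qed.

Lemma twistB j : {morph twist j : x y / x - y}.
Proof.
move=> x y; apply/ffunP => k; rewrite gaBE !twistE -sumrB.
by apply: eq_bigr => i _; rewrite gaBE (gradeB gr).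
Qed.

Lemma twistM j : {morph twist j : x y / x * y}.
Proof.
move=> x y; apply/ffunP => k; rewrite gaME twistE.
transitivity (\sum_h \sum_a \sum_i c h (x a) * c i (y (k - a - j * (i + h)))).
  under eq_bigr => i _.
    rewrite gaME cSum; under eq_bigr => a _ do rewrite (gradeM gr).
    over.
  rewrite exchange_big [RHS]exchange_big /=; apply: eq_bigr => a _.
  rewrite exchange_big; apply: eq_bigr => h _ /=.
  rewrite (reindex_inj (addIr h)) /=; apply: eq_bigr => i _.
  by rewrite addrK addrAC.
under [RHS]eq_bigr => b _.
  rewrite !twistE mulr_suml; under eq_bigr => h _ do rewrite mulr_sumr.
  over.
rewrite [RHS]exchange_big /=; apply: eq_bigr => h _.
rewrite [RHS](reindex_inj (addIr (j * h))) /=; apply: eq_bigr => a _.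
apply: eq_bigr => i _; rewrite addrK; congr (_ * c i (y _)).
by rewrite mulrDr !opprD !addrA addrAC.
Qed.

Lemma twist_comp j j' x : twist j (twist j' x) = twist (j + j') x.
Proof.
apply/ffunP => k; rewrite !twistE; apply: eq_bigr => i _.
rewrite twistE cSum (bigD1 i) //= (grade_comp gr) eqxx big1 ?addr0.
  by rewrite mulrDl opprD addrA.
by move=> h ne_hi; rewrite (grade_comp gr) eq_sym (negPf ne_hi).
Qed.

Lemma twist0 x : twist 0 x = x.
Proof.
apply/ffunP => k; rewrite twistE -[RHS](grade_sum gr).
by apply: eq_bigr => i _; rewrite mul0r subr0.
Qed.

Lemma jacobson_radical_twist j x :
  jacobson_radical S x -> jacobson_radical S (twist j x).
Proof.
apply: jacobson_radical_surj_rmorph; [exact: twistB|exact: twistM|].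
by move=> y; exists (twist (- j) y); rewrite twist_comp subrr twist0.
Qed.

(** Bergman's theorem for a grading by the additive group of a finite field.
    The radical of [R[F]] contains [r] and its twists, hence also
    [z = sum_j t^(-j l) twist_j(r) - (sum_t t) r]. For [i <> l] the exponents
    [j (i - l)] run through the whole group, so the component of degree [i]
    cancels, leaving [z = (#|F| - sum_t t) r_l]. Comparing the coefficients of
    a left inverse of [1 - a z] at two group elements makes the coefficient sum
    disappear and yields a left inverse of [1 - a #|F| r_l] in [R]. *)
Lemma jacobson_radical_component l r :
  jacobson_radical R r -> jacobson_radical R (c l r *+ #|F|).
Proof.
move=> Jr; have JSr := @jacobson_radical_group_algebra F _ _ Jr.
pose z : S := \sum_j gmon (- (j * l)) 1 * twist j (gmon 0 r)
              - (\sum_t gmon t 1) * gmon 0 r.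
have JSum (I : Type) (s : seq I) (f : I -> S) :
    (forall e : I, jacobson_radical S (f e)) ->
    jacobson_radical S (\sum_(i <- s) f i).
  move=> Jf; elim/big_ind: _ => //; first exact: jacobson_radical0.
  exact: jacobson_radicalD.
have Jz : jacobson_radical S z.
  apply: jacobson_radicalB; last exact: jacobson_radicalMl.
  apply: JSum => j; apply: jacobson_radicalMl; exact: jacobson_radical_twist.
have zE k : z k = (if k == 0 then c l r *+ #|F| else 0) - c l r.
  rewrite gaBE gMmon subr0 !sum_ffunE.
  have -> : (\sum_t gmon t (1 : R) k) = 1.
    rewrite (bigD1 k) //= gmonE eqxx big1 ?addr0 // => t.
    by rewrite gmonE eq_sym => /negPf ->.
  rewrite mul1r -[X in _ - X = _](grade_sum gr r) [X in _ - X = _](bigD1 l) //=.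
  rewrite opprD addrA addrAC.
  congr (_ - _).
  (* The degree [l] part is [#|F| r_l] at [k = 0]. *)
  under eq_bigr => j _.
    rewrite gmonM mul1r twistE.
    under eq_bigr => i _.
      rewrite gmonE opprK -addrA -mulrBr.
      over.
    rewrite (bigD1 l) //= subrr mulr0 addr0.
    over.
  rewrite big_split /= sumr_const exchange_big /= -[RHS]addr0 -addrA.
  congr (_ + _).
    by case: eqP => // _; rewrite c0 mul0rn.
  apply/eqP; rewrite subr_eq0; apply/eqP; apply: eq_bigr => i ne_il.
  (* In degree [i <> l], exactly one [j] contributes to the coefficient
     at [k]. *)
  have d0 : l - i != 0 by rewrite subr_eq0 eq_sym.
  rewrite (bigD1 (- k / (l - i))) //= mulfVK // subrr eqxx big1 ?addr0 //.
  move=> j; rewrite (_ : (_ == 0) = (j == - k / (l - i))) => [/negPf->//|].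
  by rewrite addrC addr_eq0 (can2_eq (mulfK d0) (mulfVK d0)).
have {Jz} /jacobson_radicalP invz := Jz; apply/jacobson_radicalP => a.
have [y /ffunP y1] := invz (gmon 0 a).
have yE k : y k - (y k * a * (c l r *+ #|F|) - (\sum_i y i) * a * c l r)
    = if k == 0 then 1 else 0.
  rewrite -ga1E -y1 mulrBr mulr1 gaBE gaME; congr (_ - _).
  transitivity (\sum_i y i * (a *
    ((if k - i == 0 then c l r *+ #|F| else 0) - c l r))).
    under [RHS]eq_bigr => i _ do rewrite mulrBr mulrBr !mulrA.
    rewrite sumrB -!mulr_suml; congr (_ - _).
    rewrite (bigD1 k) //= subrr eqxx big1 ?addr0 // => i.
    by rewrite eq_sym -subr_eq0 => /negPf ->; rewrite mulr0.
  by apply: eq_bigr => i _; rewrite gmonM subr0 zE.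
exists (y 0 - y 1).
have := congr2 (fun e e' => e - e') (yE 0) (yE 1).
rewrite eqxx oner_eq0 subr0 => E; apply: etrans E.
set s := (\sum_i y i) * a * c l r.
rewrite mulrBr mulr1 mulrBl !mulrA !opprB !addrA.
by rewrite [RHS](ACl (1*6*4*3*(2*5))%AC) /= subrr addr0.
Qed.

End Bergman.

(** * Words avoiding a set of factors *)

Section WordCombinatorics.
Variable n : nat.
Implicit Types (u v w b : words n) (O : set (words n)).

Definition avoids O u := forall v, O v -> ~ divides v u.

Lemma dividesP v u : divides v u <-> infix v u.
Proof.
split=> [[w [s ->]]|/infixP[w [s us]]].
  by apply/infixP; exists w, s; rewrite !fmM catA.
exists (FMonom w), (FMonom s); apply: val_inj.
by rewrite /= !fmM us catA.
Qed.

(** A factor no longer than [b] cannot reach across [b]. *)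
Lemma infix_cat_overlap (T : eqType) (z a b c : seq T) : (size z <= size b)%N ->
  infix z (a ++ b ++ c) -> infix z (a ++ b) || infix z (b ++ c).
Proof.
move=> le_zb /infixP[p [s E]].
have [le_ap|lt_pa] := leqP (size a) (size p).
  apply/orP; right; apply/infixP; exists (drop (size a) p), s.
  have := congr1 (drop (size a)) E.
  by rewrite drop_size_cat // drop_cat; case: ltngtP le_ap => // ->;
     rewrite subnn drop0 drop_size.
apply/orP; left; apply/infixP.
exists p, (take (size (a ++ b) - size (p ++ z)) s).
have := congr1 (take (size (a ++ b))) E.
rewrite catA take_size_cat // => E'; apply: etrans E' _.
have le_pz : (size (p ++ z) <= size (a ++ b))%N.
  by rewrite !size_cat leq_add // ltnW.
by rewrite catA take_cat ltnNge le_pz /= catA.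
Qed.

Definition wpow w k : words n := iter k (mmul w) mone.

Lemma avoids_factor O a u b : avoids O (mmul (mmul a u) b) -> avoids O u.
Proof.
move=> avO v Ov [w [s us]]; apply: (avO v Ov).
by exists (mmul a w), (mmul s b); rewrite us !mulmA.
Qed.

(** With obstructions of bounded length and the extension property that
    semi-primeness provides, every nonempty admissible word is a prefix of a
    word whose powers are all admissible. *)
Section Extension.
Variables (O : set (words n)) (N : nat).
Hypothesis sizeO : forall v, O v -> (size v <= N)%N.
Hypothesis extO :
  forall u, avoids O u -> exists w, avoids O (mmul (mmul u w) u).

Lemma avoids_long u k : avoids O u -> u <> mone ->
  exists b, avoids O (mmul u b) /\ (k <= size (mmul u b))%N.
Proof.
move=> avu u1; elim: k => [|k [b [avub kub]]].
  by exists mone; rewrite mulm1.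
have [w avw] := extO avub; exists (mmul (mmul b w) (mmul u b)).
rewrite !mulmA in avw *; split=> //.
rewrite !fmM !size_cat in kub *.
have : (0 < size u)%N by rewrite lt0n; apply/eqP => /fdeg_eq0I.
move=> u_gt0; apply: leq_ltn_trans kub _; rewrite -!addnA ltn_add2l.
by rewrite -[X in (X < _)%N]addn0 ltn_add2l addnCA ltn_addr.
Qed.

(** Extend [u] to [u'] at least as long as every obstruction and choose [w]
    with [u' w u'] admissible. A factor of [(u' w)^k u'] of the length of an
    obstruction lies inside some [u' w u'], so [(u' w)^k] is admissible. *)
Lemma avoids_wpow u : avoids O u -> u <> mone ->
  exists b, forall k, avoids O (wpow (mmul u b) k).
Proof.
move=> avu u1; have [b [avub Nub]] := avoids_long N avu u1.
have [w avw] := extO avub; exists (mmul b w) => k.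
rewrite mulmA; move: (mmul u b) avub Nub avw => {avu u1 b}u avu Nu avw.
suff avk : avoids O (mmul (wpow (mmul u w) k) u).
  by apply: (@avoids_factor O mone _ u); rewrite mul1m.
have u_prefix k' : exists q, mmul (wpow (mmul u w) k') u = mmul u q.
  case: k' => [|k']; first by exists mone; rewrite mul1m mulm1.
  by exists (mmul (mmul w (wpow (mmul u w) k')) u); rewrite /= !mulmA.
elim: k => [|k IHk]; first by rewrite mul1m.
move=> v Ov /dividesP; have [q uq] := u_prefix k.
have := IHk v Ov; rewrite /= -mulmA uq !fmM => avuq.
have := avw v Ov => avuw /infix_cat_overlap; rewrite (leq_trans (sizeO Ov)) //.
by case/(_ isT)/orP => iv; [apply: avuw | apply: avuq]; apply/dividesP;
   rewrite !fmM.
Qed.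

End Extension.

End WordCombinatorics.

(** * Two-sided ideals and quotients *)

Section IdealTheory.
Variables (R : pzRingType) (U : set R).
Implicit Types (x y a : R).

Lemma ideal_gen0 : ideal_gen U 0.
Proof. by have [[]] := two_sided_ideal_gen U. Qed.

Lemma ideal_genD x y : ideal_gen U x -> ideal_gen U y -> ideal_gen U (x + y).
Proof. by have [[_ + _] _] := two_sided_ideal_gen U; apply. Qed.

Lemma ideal_genMl a x : ideal_gen U x -> ideal_gen U (a * x).
Proof. by have [[_ _ +] _] := two_sided_ideal_gen U; apply. Qed.

Lemma ideal_genMr a x : ideal_gen U x -> ideal_gen U (x * a).
Proof. by have [_ +] := two_sided_ideal_gen U; apply. Qed.

Lemma ideal_genN x : ideal_gen U x -> ideal_gen U (- x).
Proof. by rewrite -mulN1r; apply: ideal_genMl. Qed.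

Lemma ideal_gen_sum (I : Type) (s : seq I) (f : I -> R) :
  (forall i, ideal_gen U (f i)) -> ideal_gen U (\sum_(i <- s) f i).
Proof.
move=> If; elim/big_ind: _ => //; first exact: ideal_gen0.
exact: ideal_genD.
Qed.

Lemma quot_proj_eq0 x : quot_proj U x = 0 <-> ideal_gen U x.
Proof. by rewrite -[x in ideal_gen U x]subr0 -quot_proj_eqP raddf0. Qed.

End IdealTheory.

(** * Degree components of the free algebra *)

Section Homogeneous.
Variables (K : fieldType) (n : nat) (T : zmodType) (d : words n -> T).
Implicit Types (x y : free_alg K n) (i j : T).

Definition of_degree i x := forall w, w \in msupp x -> d w = i.

Lemma of_degreeM i j x y : (forall u v, d (mmul u v) = d u + d v) ->
  of_degree i x -> of_degree j y -> of_degree (i + j) (x * y).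
Proof. by move=> dM xi yj w /msuppM_le[u [v [/xi<- /yj<- ->]]]. Qed.

End Homogeneous.

Section Components.
Variables (K : fieldType) (n : nat) (T : finZmodType) (d : words n -> T).
Hypothesis dM : forall u v, d (mmul u v) = d u + d v.
Local Notation A := (free_alg K n).
Implicit Types (x y f : A) (i j : T).

Definition component i x : A :=
  [malg w in msupp x => if d w == i then x@_w else 0].

Lemma mcoeff_component i x w :
  (component i x)@_w = if d w == i then x@_w else 0.
Proof. by rewrite mcoeffE; case: msuppP; case: ifP. Qed.

Lemma componentB i : {morph component i : x y / x - y}.
Proof.
move=> x y; apply/malgP => w; rewrite mcoeffB !mcoeff_component mcoeffB.
by case: ifP; rewrite ?subr0.
Qed.

Lemma component0 i : component i 0 = 0.
Proof. by have := componentB i 0 0; rewrite !subrr. Qed.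

Lemma componentN i : {morph component i : x / - x}.
Proof. by move=> x; rewrite -sub0r componentB component0 sub0r. Qed.

Lemma componentD i : {morph component i : x y / x + y}.
Proof. by move=> x y; rewrite -[y]opprK componentB !componentN. Qed.

Lemma component_sum i (I : Type) (s : seq I) (f : I -> A) :
  component i (\sum_(k <- s) f k) = \sum_(k <- s) component i (f k).
Proof. exact: (big_morph (component i) (componentD i) (component0 i)). Qed.

Lemma sum_component x : \sum_i component i x = x.
Proof.
apply/malgP => w; rewrite raddf_sum (bigD1 (d w)) //= mcoeff_component eqxx.
by rewrite big1 ?addr0 // => i; rewrite mcoeff_component eq_sym => /negPf ->.
Qed.

Lemma of_degree_component i x : of_degree d i (component i x).
Proof.
move=> w; rewrite -mcoeff_neq0 mcoeff_component.
by case: (d w =P i) => //; rewrite eqxx.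
Qed.

Lemma component_of_degree i j x :
  of_degree d j x -> component i x = if i == j then x else 0.
Proof.
move=> xj; apply/malgP => w; rewrite mcoeff_component.
case: (msuppP x w) => [/xj->|xw].
  by rewrite eq_sym; case: eqP; rewrite ?mcoeff0.
by case: ifP => _; case: ifP => _; rewrite ?mcoeff0 // (mcoeff_outdom xw).
Qed.

Lemma component_comp i j x :
  component i (component j x) = if i == j then component i x else 0.
Proof.
rewrite (component_of_degree _ (@of_degree_component j x)).
by case: eqP => // ->.
Qed.

Lemma componentM i x y :
  component i (x * y) = \sum_h component h x * component (i - h) y.
Proof.
rewrite -{1}(sum_component x) -{1}(sum_component y) mulr_suml component_sum.
apply: eq_bigr => h _; rewrite mulr_sumr component_sum (bigD1 (i - h)) //=.
have cM j : component i (component h x * component j y)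
    = if i == h + j then component h x * component j y else 0.
  apply: component_of_degree; apply: of_degreeM dM _ _;
  exact: of_degree_component.
rewrite -[RHS]addr0; congr (_ + _).
  by apply: etrans (cM _) _; rewrite subrKC eqxx.
apply: big1 => j ne_j; apply: etrans (cM j) _.
by rewrite addrC -subr_eq eq_sym (negPf ne_j).
Qed.

Variable G : set A.
Hypothesis G_homog : forall g, G g -> exists j, of_degree d j g.

(** An ideal generated by homogeneous elements is homogeneous: the elements all
    of whose components lie in it form an ideal containing the generators. *)
Lemma component_ideal i x : ideal_gen G x -> ideal_gen G (component i x).
Proof.
move=> Ix; pose I' := [set x | forall i, ideal_gen G (component i x)].
have : I' x; last by apply.
apply: Ix; split; last first.
  move=> g Gg j; have [k gk] := G_homog Gg.
  rewrite (component_of_degree j gk); case: ifP => _; last exact: ideal_gen0.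
  exact: sub_ideal_gen.
split; first split.
- by move=> j; rewrite component0; apply: ideal_gen0.
- by move=> y z Iy Iz j; rewrite componentD; apply: ideal_genD.
- move=> a y Iy j; rewrite componentM; apply: ideal_gen_sum => h.
  exact: ideal_genMl.
- move=> a y Iy j; rewrite componentM; apply: ideal_gen_sum => h.
  exact: ideal_genMr.
Qed.

Definition quot_component i (a : quot_ideal G) : quot_ideal G :=
  quot_proj G (component i (repr a)).

Lemma quot_component_proj i x :
  quot_component i (quot_proj G x) = quot_proj G (component i x).
Proof.
apply/quot_proj_eqP; rewrite -componentB; apply: component_ideal.
by apply/quot_proj_eqP; rewrite quot_projK.
Qed.

Lemma quot_component_grading : is_grading quot_component.
Proof.
split=> [i a b|a|i j a|i a b].
- rewrite -[a]quot_projK -[b]quot_projK -raddfB !quot_component_proj.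
  by rewrite componentB raddfB.
- by rewrite -[RHS]quot_projK -[in RHS](sum_component (repr a)) raddf_sum.
- rewrite -[a]quot_projK !quot_component_proj component_comp.
  by case: eqP; rewrite ?raddf0.
- rewrite -[a]quot_projK -[b]quot_projK -rmorphM quot_component_proj componentM.
  rewrite raddf_sum; apply: eq_bigr => h _.
  by rewrite !quot_component_proj -rmorphM.
Qed.

End Components.

(** * Monomial ideals *)

Section MonomialAlgebra.
Variables (K : fieldType) (n : nat) (O : set (words n)).
Implicit Types (u v w : words n) (x : free_alg K n).

Lemma monomial_ideal_divides x u :
  ideal_gen (monomials K O) x -> u \in msupp x -> exists2 v, O v & divides v u.
Proof.
pose I := [set x : free_alg K n |
  forall u, u \in msupp x -> exists2 v, O v & divides v u].
move=> Ix; have : I x; last by apply.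
apply: Ix; split; last first.
  move=> _ [v Ov <-] w; rewrite msuppU1 in_fset1 => /eqP ->.
  by exists v => //; exists mone, mone; rewrite mul1m mulm1.
split; first split.
- by move=> w; rewrite msupp0 in_fset0.
- move=> y z Iy Iz w /(fsubsetP (msuppD_le _ _)).
  by rewrite in_fsetU => /orP[/Iy|/Iz].
- move=> a y Iy _ /msuppM_le[w [w' [_ /Iy[v Ov [p [s ->]]] ->]]].
  by exists v => //; exists (mmul w p), s; rewrite !mulmA.
- move=> a y Iy _ /msuppM_le[w [w' [/Iy[v Ov [p [s ->]]] _ ->]]].
  by exists v => //; exists p, (mmul s w'); rewrite !mulmA.
Qed.

Lemma divides_monomial_ideal (c : K) u v :
  O v -> divides v u -> ideal_gen (monomials K O) << c *g u >>.
Proof.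
move=> Ov [w [s ->]].
have -> : << c *g mmul (mmul w v) s >> = << c *g w >> * << v >> * << s >>
    :> free_alg K n.
  by rewrite !malgM_def !fgmulUU !mulr1.
apply: ideal_genMr; apply: ideal_genMl; apply: sub_ideal_gen.
by exists v.
Qed.

(** If every [u w u] met an obstruction, [u] times the whole algebra times [u]
    would vanish in the monomial algebra, where [u] is nonzero. *)
Lemma semi_prime_avoids u : semi_prime (quot_ideal (monomials K O)) ->
  avoids O u -> exists w, avoids O (mmul (mmul u w) u).
Proof.
move=> spO avu; apply: contrapT => noext.
have : quot_proj (monomials K O) << u >> = 0.
  apply: spO => r; set a := quot_proj _ _.
  have -> : a * r * a = quot_proj (monomials K O) (<< u >> * repr r * << u >>).
    by rewrite 2!rmorphM /= quot_projK.
  apply/quot_proj_eq0.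
  rewrite [repr r]monalgE mulr_sumr mulr_suml; apply: ideal_gen_sum => w.
  have [v Ov vd] : exists2 v, O v & divides v (mmul (mmul u w) u).
    apply: contrapT => nov; apply: noext; exists w => v Ov vd.
    by apply: nov; exists v.
  by rewrite !malgM_def !fgmulUU; apply: divides_monomial_ideal Ov vd.
move=> /quot_proj_eq0 /(@monomial_ideal_divides _ u)[|v Ov vu].
  by rewrite msuppU1 in_fset1.
exact: avu vu.
Qed.

End MonomialAlgebra.

(** * Leading monomials *)

Section LeadingMonomialTheory.
Variables (K : fieldType) (n : nat) (prec : rel (words n)).
Hypothesis ordP : monomial_ordering prec.
Local Notation A := (free_alg K n).
Implicit Types (u v w : words n) (x y f g : A).

Lemma prec_mull w u v : prec u v -> prec (mmul w u) (mmul w v).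
Proof. by move=> uv; have := mord_compat ordP w mone uv; rewrite !mulm1. Qed.

Lemma prec_mulr w u v : prec u v -> prec (mmul u w) (mmul v w).
Proof. by move=> uv; have := mord_compat ordP mone w uv; rewrite !mul1m. Qed.

Lemma prec_mul u u' v v' :
  prec u' u -> prec v' v -> prec (mmul u' v') (mmul u v).
Proof.
by move=> uu vv; apply: mord_trans ordP _ _ _ (prec_mull _ vv) (prec_mulr _ uu).
Qed.

Lemma mmul_top_inj u u' v v' :
  (u' = u \/ prec u' u) -> (v' = v \/ prec v' v) ->
  mmul u' v' = mmul u v -> u' = u /\ v' = v.
Proof.
have irr := mord_irr ordP.
case=> [->|uu] [->|vv] E //.
- by have := prec_mull u vv; rewrite E irr.
- by have := prec_mulr v uu; rewrite E irr.
- by have := prec_mul uu vv; rewrite E irr.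
Qed.

Lemma leading_monomial_le x u w :
  leading_monomial prec x u -> w \in msupp x -> w = u \/ prec w u.
Proof.
move=> [_ xmax] xw; have [->|/eqP ne] := eqVneq w u; first by left.
by right; apply: xmax.
Qed.

(** The coefficient of the top product receives a single contribution. *)
Lemma leading_monomialM x y u v :
  leading_monomial prec x u -> leading_monomial prec y v ->
  leading_monomial prec (x * y) (mmul u v).
Proof.
move=> xu yv; have [[ux _] [vy _]] := (xu, yv); split.
  rewrite -mcoeff_neq0 mcoeffMl (big_fsetD1 u) //= (big_fsetD1 v) //=.
  rewrite eqxx mulr1n big1_fset ?addr0.
    rewrite big1_fset ?addr0 ?mulf_neq0 ?mcoeff_neq0 //.
    move=> u'; rewrite in_fsetD1 => /andP[/eqP ne_u u'x] _.
    rewrite big1_fset // => v' v'y _; case: eqP => // E.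
    have [lex ley] := (leading_monomial_le xu u'x, leading_monomial_le yv v'y).
    by have [/ne_u] := mmul_top_inj lex ley E.
  move=> v'; rewrite in_fsetD1 => /andP[/eqP ne_v v'y] _; case: eqP => // E.
  have ley := leading_monomial_le yv v'y.
  by have [_ /ne_v] := mmul_top_inj (or_introl (erefl u)) ley E.
move=> _ /msuppM_le[u' [v' [u'x v'y ->]]] ne.
case: (leading_monomial_le xu u'x) (leading_monomial_le yv v'y) ne.
  by move=> -> [-> //|/prec_mull].
by move=> uu [-> _|vv _]; [apply: prec_mulr | apply: prec_mul].
Qed.

Lemma leading_monomialU (c : K) w :
  c != 0 -> leading_monomial prec (<< c *g w >> : A) w.
Proof.
move=> c0; rewrite /leading_monomial msuppU (negPf c0).
by split=> [|v]; rewrite in_fset1 // => /eqP.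
Qed.

Lemma leading_monomialX x u k :
  leading_monomial prec x u -> leading_monomial prec (x ^+ k) (wpow u k).
Proof.
move=> xu; elim: k => [|k IHk].
  by apply: leading_monomialU; apply: oner_neq0.
by rewrite exprS; apply: leading_monomialM.
Qed.

Variable G : set A.
Hypothesis G_groebner : groebner_basis prec G (ideal_gen G).

(** [u] would lie in [<LM(I)> = <LM(G)>], and a word of the latter ideal is
    divisible by an element of [LM(G)]. *)
Lemma avoids_LM_notin_ideal x u : leading_monomial prec x u ->
  avoids (LM prec G) u -> ~ ideal_gen G x.
Proof.
move=> xu avu Ix; have [_ eqLM] := G_groebner.
have : ideal_gen (monomials K (LM prec (ideal_gen G))) << u >>.
  by apply: sub_ideal_gen; exists u => //; exists x.
rewrite eqLM => /(@monomial_ideal_divides _ _ _ _ u)[|v Gv]; last exact: avu.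
by rewrite msuppU1 in_fset1.
Qed.

(** Division by the Groebner basis, carried only as far as the leading
    monomial: while some [LM g] divides it, a homogeneous multiple of [g]
    cancels it, and the well-founded ordering stops the process. *)
Lemma leading_monomial_reduction (T : zmodType) (d : words n -> T) l x :
    (forall u v, d (mmul u v) = d u + d v) ->
    (forall g, G g -> exists j, of_degree d j g) ->
    of_degree d l x -> ~ ideal_gen G x ->
  exists y u, [/\ of_degree d l y, ideal_gen G (x - y),
    leading_monomial prec y u & avoids (LM prec G) u].
Proof.
move=> dM G_homog xl Ix.
have [|u xu] := leading_monomial_exists ordP (f := x) _.
  by apply: contra_notN Ix => /eqP ->; apply: ideal_gen0.
elim/(well_founded_ind (mord_wf ordP)): u x xl Ix xu => u IHu x xl Ix xu.
have [avu|] := pselect (avoids (LM prec G) u).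
  by exists x, u; split=> //; rewrite subrr; apply: ideal_gen0.
move=> /existsNP[v /not_implyP[[g Gg gv] /contrapT[w [s us]]]].
pose t : A := << w >> * g * << s >>.
have tu : leading_monomial prec t u.
  by rewrite us; do !apply: leading_monomialM => //; apply: leading_monomialU;
     apply: oner_neq0.
have It : ideal_gen G t.
  by apply: ideal_genMr; apply: ideal_genMl; apply: sub_ideal_gen.
have tl : of_degree d l t.
  have [j gj] := G_homog g Gg.
  have U z : of_degree d (d z) (<< z >> : A).
    by move=> z'; rewrite msuppU1 in_fset1 => /eqP ->.
  have tj := of_degreeM dM (of_degreeM dM (U w) gj) (U s).
  have <- : d w + j + d s = l; last exact: tj.
  by rewrite -(tj u) ?(xl u) //; [case: xu|case: tu].
have tu0 : t@_u != 0 by rewrite mcoeff_neq0; case: tu.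
pose c := x@_u / t@_u; pose x1 := x - c *: t.
have Ict : ideal_gen G (c *: t) by rewrite -mul_malgC; apply: ideal_genMl.
have Ix1 : ~ ideal_gen G x1.
  by move=> Ix1; apply: Ix; rewrite -[x](subrK (c *: t)); apply: ideal_genD.
have supp1 z : z \in msupp x1 -> z \in msupp x \/ z \in msupp t.
  move=> /(fsubsetP (msuppB_le _ _)); rewrite in_fsetU.
  case/orP; first by left.
  by move=> /(fsubsetP (msuppZ_le _ _)); right.
have [|u1 x1u1] := leading_monomial_exists ordP (f := x1) _.
  by apply: contra_notN Ix1 => /eqP ->; apply: ideal_gen0.
have u1u : prec u1 u.
  have [u1x1 _] := x1u1.
  have ne_u : u1 <> u.
    move=> E; move: u1x1; rewrite E -mcoeff_neq0 mcoeffB mcoeffZ.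
    by rewrite mulfVK // subrr eqxx.
  have le_u z : z \in msupp x1 -> z = u \/ prec z u.
    by case/supp1; apply: leading_monomial_le.
  by case: (le_u u1 u1x1).
have [z|y [u2 [yl Iy yu2 avu2]]] := IHu u1 u1u x1 _ Ix1 x1u1.
  by move=> /supp1[/xl|/tl].
exists y, u2; split=> //.
rewrite -[x](subrK (c *: t)) -/x1 addrAC; exact: ideal_genD.
Qed.

Lemma LM_size_bound (S : set A) : finite_set S ->
  exists N, forall v, LM prec S v -> (size v <= N)%N.
Proof.
move=> /finite_seqP[s ->].
exists (\max_(g <- s) \max_(w <- msupp g) size w)%N => v [g /= gs [vg _]].
apply: leq_trans (leq_bigmax_seq _ gs isT) => /=.
exact: leq_bigmax_seq.
Qed.

End LeadingMonomialTheory.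

(** * Weight degrees modulo a large prime *)

Lemma prime_neq0 (K : fieldType) N :
  exists p, [/\ prime p, (N < p)%N & p%:R != 0 :> K].
Proof.
have [p Np p_pr] := prime_above N.
have [p0|] := boolP (p%:R == 0 :> K); last by exists p.
have [q pq q_pr] := prime_above p.
exists q; split=> //; first exact: ltn_trans pq.
have charp : p \in [pchar K] by rewrite inE p_pr p0.
apply/negP => q0; have : q \in [pchar K] by rewrite inE q_pr q0.
by rewrite (pcharf_eq charp) inE => /eqP E; rewrite E ltnn in pq.
Qed.

Lemma natr_Fp_inj p a b : prime p -> (a < p)%N -> (b < p)%N ->
  a%:R = b%:R :> 'F_p -> a = b.
Proof.
by move=> p_pr ap bp /(congr1 val); rewrite /= !val_Fp_nat // !modn_small.
Qed.

Section WeightDegree.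
Variables (n : nat) (m : 'I_n -> nat).
Implicit Types (u v w : words n).

Lemma wdegM u v : wdeg m (mmul u v) = (wdeg m u + wdeg m v)%N.
Proof. by rewrite /wdeg fmM big_cat. Qed.

Lemma wdeg_gt0 w : (forall i, 0 < m i)%N -> w <> mone -> (0 < wdeg m w)%N.
Proof.
move=> m_gt0; case: w => [[|i s]] w1; last by rewrite /wdeg big_cons ltn_addr.
by case: w1; apply: val_inj; rewrite /= fm1.
Qed.

(** The weight read in a ring: in the integers to keep exact degrees, and modulo
    a large prime to get a grading by a finite field. *)
Definition ring_wdeg (R : pzRingType) w : R := (wdeg m w)%:R.

Lemma ring_wdegM (R : pzRingType) u v :
  ring_wdeg R (mmul u v) = ring_wdeg R u + ring_wdeg R v.
Proof. by rewrite /ring_wdeg wdegM natrD. Qed.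

Lemma homogeneous_of_degree_ring_wdeg (K : fieldType) (R : pzRingType) l
    (x : free_alg K n) :
  homogeneous_of_degree m l x -> of_degree (ring_wdeg R) l%:R x.
Proof. by move=> xl w /xl wl; rewrite /ring_wdeg wl. Qed.

Lemma homogeneous_ring_wdeg (K : fieldType) (R : pzRingType)
    (x : free_alg K n) :
  homogeneous m x -> exists j, of_degree (ring_wdeg R) j x.
Proof.
by move=> [l xl]; exists l%:R; apply: homogeneous_of_degree_ring_wdeg.
Qed.

Lemma wdeg_bound (K : fieldType) (x : free_alg K n) :
  exists N, forall w, w \in msupp x -> (wdeg m w < N)%N.
Proof.
exists (\max_(w <- msupp x) wdeg m w).+1 => w xw.
by rewrite ltnS; apply: leq_bigmax_seq xw isT.
Qed.

End WeightDegree.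

(** * Homogeneous elements of the radical *)

Section HomogeneousRadical.
Variables (K : fieldType) (n : nat) (m : 'I_n -> nat).
Hypothesis m_gt0 : forall i, (0 < m i)%N.
Variables (prec : rel (words n)) (G : set (free_alg K n)).
Hypothesis prec_ord : monomial_ordering prec.
Hypothesis G_finite : finite_set G.
Hypothesis G_homog : forall g, G g -> homogeneous m g.
Hypothesis G_groebner : groebner_basis prec G (ideal_gen G).
Implicit Types (x y : free_alg K n) (u : words n).

Let G_ring_homog (R : pzRingType) g :
  G g -> exists j, of_degree (ring_wdeg m R) j g.
Proof. by move=> /G_homog; apply: homogeneous_ring_wdeg. Qed.

(** The left inverse of [1 - x] would have to be the geometric series, whose
    term of degree [k l] is [x^k]; as [y] has finitely many components, these
    terms vanish for large [k]. Degrees are read modulo a prime [p] so large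
    that none of the degrees compared wrap around. *)
Lemma quasi_inverse_nilpotent l x y :
    homogeneous_of_degree m l x -> (0 < l)%N ->
    ideal_gen G (y * (1 - x) - 1) ->
  exists k, ideal_gen G (x ^+ k).
Proof.
move=> xl l_gt0 Iy; have [N yN] := wdeg_bound m y.
(* The three summands keep [k l] for [k <= N], and [d + l] for [d < N], below
   [p]. *)
have [p [p_pr pN _]] := prime_neq0 K (N * l + N + l).
pose c (i : 'F_p) (z : free_alg K n) := component (ring_wdeg m 'F_p) i z.
have deg1 : of_degree (ring_wdeg m 'F_p) 0 (1 : free_alg K n).
  move=> w; rewrite msuppU1 in_fset1 => /eqP->.
  by rewrite /ring_wdeg /wdeg fm1 big_nil.
have xlp := homogeneous_of_degree_ring_wdeg 'F_p xl.
(* The component of degree [i] of the relation [y (1 - x) = 1]. *)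
have cIy i :
  ideal_gen G (c i y - c (i - l%:R) y * x - (if i == 0 then 1 else 0)).
  have := component_ideal (@ring_wdegM n m 'F_p) (@G_ring_homog _) i Iy.
  rewrite mulrBr mulr1 !componentB (componentM (@ring_wdegM n m 'F_p)).
  rewrite (bigD1 (i - l%:R)) //=.
  rewrite subKr (component_of_degree _ xlp) eqxx.
  rewrite big1 ?addr0 => [|j ne_j].
    by rewrite (component_of_degree _ deg1).
  rewrite (component_of_degree _ xlp).
  by rewrite subr_eq addrC -subr_eq eq_sym (negPf ne_j) mulr0.
have cy0 i : (forall d, (d < N)%N -> d%:R != i) -> c i y = 0.
  move=> dN; apply/malgP => w; rewrite mcoeff0 mcoeff_component.
  by case: msuppP => [/yN/dN/negPf->//|_]; rewrite if_same.
have ck k : (k <= N)%N -> ideal_gen G (c (k * l)%:R y - x ^+ k).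
  elim: k => [_|k IHk kN].
    have := cIy 0; rewrite eqxx sub0r (cy0 (- l%:R)).
      by rewrite mul0r subr0 expr0.
    move=> d dN.
    apply/eqP => E; have : (d + l)%:R = 0%:R :> 'F_p by rewrite natrD E addNr.
    move=> /(natr_Fp_inj p_pr) E'.
    have := E' _ (prime_gt0 p_pr); rewrite (leq_trans _ pN) => [/(_ isT) /eqP|].
      by rewrite addn_eq0 eqn0Ngt [in X in _ && X]eqn0Ngt l_gt0 andbF.
    by rewrite ltnS leq_add2r (leq_trans (ltnW dN)) // leq_addl.
  have := cIy (k.+1 * l)%:R.
  rewrite ifF; last first.
    apply/eqP => /(@natr_Fp_inj p _ 0 p_pr) E.
    have := E _ (prime_gt0 p_pr); rewrite (leq_trans _ pN) => [/(_ isT) /eqP|].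
      by rewrite muln_eq0 /= eqn0Ngt l_gt0.
    by rewrite ltnS -addnA (leq_trans _ (leq_addr _ _)) // leq_mul2r kN orbT.
  rewrite subr0 mulSn natrD [l%:R + _]addrC addrK => Ik.
  rewrite exprSr -(subrK (c (k * l)%:R y * x) (c _ y)) -addrA -mulrBl.
  apply: ideal_genD Ik _; apply: ideal_genMr; exact: IHk (ltnW kN).
exists N; have := ck N (leqnn _); rewrite cy0 ?sub0r => [/ideal_genN|d dN].
  by rewrite opprK.
apply/eqP => /(natr_Fp_inj p_pr) E.
have dNl : (d < N * l)%N by rewrite (leq_trans dN) // leq_pmulr.
have Nlp : (N * l < p)%N by rewrite (leq_trans _ pN) // ltnS -addnA leq_addr.
by have := dNl; rewrite (E (ltn_trans dNl Nlp) Nlp) ltnn.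
Qed.

Hypothesis spO : semi_prime (quot_ideal (monomials K (LM prec G))).

(** If [u = 1], then [x] is a nonzero scalar, so a unit. Otherwise some word
    [b] makes every power of [u b] admissible: [x b] would be a homogeneous
    element of the radical of positive degree, hence nilpotent, although its
    powers have the admissible leading monomials [(u b)^k]. *)
Lemma homogeneous_avoids_notin_jacobson_radical l x u :
    homogeneous_of_degree m l x -> leading_monomial prec x u ->
    avoids (LM prec G) u ->
  ~ jacobson_radical (quot_ideal G) (quot_proj G x).
Proof.
move=> xl xu avu Jx; have ux : u \in msupp x by case: xu.
have [u1|u1] := pselect (u = mone).
  have xE : x = (x@_u)%:MP.
    apply/malgP => w; rewrite mcoeffC; case: eqP => [->|/= w1].
      by rewrite u1.
    case: msuppP => // xw; have := wdeg_gt0 m_gt0 w1.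
    by rewrite (xl _ xw) -(xl _ ux) u1 /wdeg fm1 big_nil.
  have [z] := (jacobson_radicalP _).1 Jx (quot_proj G ((x@_u)^-1)%:MP).
  rewrite -rmorphM [x in _%:MP * x]xE -rmorphM mulVf ?mcoeff_neq0 //.
  rewrite !rmorph1 subrr mulr0 => /esym /quot_proj_eq0.
  apply: (avoids_LM_notin_ideal G_groebner _ avu).
  by rewrite u1; apply: leading_monomialU; apply: oner_neq0.
have [N sizeO] := LM_size_bound prec G_finite.
have [b avub] := avoids_wpow sizeO (fun v => semi_prime_avoids spO) avu u1.
pose h := x * << b >>.
have hub : leading_monomial prec h (mmul u b).
  by apply: leading_monomialM => //; apply: leading_monomialU; apply: oner_neq0.
have hl : homogeneous_of_degree m (l + wdeg m b) h.
  move=> _ /msuppM_le[w [w' [/xl<- + ->]]].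
  by rewrite msuppU1 in_fset1 => /eqP->; rewrite wdegM.
have l_gt0 : (0 < l + wdeg m b)%N.
  by rewrite ltn_addr // -(xl _ ux) wdeg_gt0.
have [z] := jacobson_left_inverse (jacobson_radicalMr (quot_proj G << b >>) Jx).
rewrite -[z]quot_projK -rmorphM -(rmorph1 (quot_proj G)) -rmorphB -rmorphM.
move=> /quot_proj_eqP /(quasi_inverse_nilpotent hl l_gt0)[k].
apply: (avoids_LM_notin_ideal G_groebner _ (avub k)).
exact: leading_monomialX.
Qed.

End HomogeneousRadical.

Theorem theorem3p2 (K : fieldType) (n : nat)
    (m : 'I_n -> nat) (m_gt0 : forall i, (0 < m i)%N)
    (prec : rel (words n)) (prec_ord : monomial_ordering prec)
    (G : set (free_alg K n)) (G_finite : finite_set G)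
    (G_homog : forall g, G g -> homogeneous m g)
    (G_groebner : groebner_basis prec G (ideal_gen G))
    (LMG_letters : LM prec G `&` letters n = set0)
    (LMG_reduced : reduced (LM prec G)) :
  semi_prime (quot_ideal (monomials K (LM prec G))) ->
  semiprimitive (quot_ideal G).
Proof.
move=> spO; apply/seteqP; split=> [a Ja|_ ->]; last exact: jacobson_radical0.
rewrite /= -[a]quot_projK in Ja *; move: (repr a) Ja => {a}x Jx.
apply/quot_proj_eq0; apply: contrapT => Ix.
have [N xN] := wdeg_bound m x.
have [p [p_pr Np p0]] := prime_neq0 K N.
(* As [p] exceeds every degree in [x], the components modulo [p] are those of
   the weight grading. *)
pose c (i : 'F_p) (z : free_alg K n) := component (ring_wdeg m 'F_p) i z.
have G_ring_homog (R : pzRingType) g :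
    G g -> exists j, of_degree (ring_wdeg m R) j g.
  by move=> /G_homog; apply: homogeneous_ring_wdeg.
have [i Ici] : exists i, ~ ideal_gen G (c i x).
  apply: contrapT => Ic; apply: Ix.
  rewrite -(sum_component (ring_wdeg m 'F_p) x).
  apply: ideal_gen_sum => i; apply: contrapT => Ici; apply: Ic.
  by exists i.
have ci : homogeneous_of_degree m i (c i x).
  move=> w; rewrite -mcoeff_neq0 mcoeff_component.
  case: (ring_wdeg m 'F_p w =P i) => [<-|_]; last by rewrite eqxx.
  rewrite mcoeff_neq0 => /xN wN; rewrite /ring_wdeg val_Fp_nat // modn_small //.
  exact: ltn_trans Np.
have [y [u [yi Iy yu avu]]] :=
  leading_monomial_reduction prec_ord (@ring_wdegM n m int) (@G_ring_homog _)
    (homogeneous_of_degree_ring_wdeg int ci) Ici.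
have ypi : homogeneous_of_degree m i (y *+ p).
  move=> w /(fsubsetP (msuppMn_le _ _)) /yi /eqP.
  by rewrite /ring_wdeg !natz eqz_nat => /eqP.
have ypu : leading_monomial prec (y *+ p) u.
  by rewrite -scaler_nat /leading_monomial msuppZ (negPf p0).
apply: (homogeneous_avoids_notin_jacobson_radical m_gt0 prec_ord G_finite
  G_homog G_groebner spO ypi ypu avu).
have gr := quot_component_grading (@ring_wdegM n m 'F_p) (@G_ring_homog 'F_p).
have := jacobson_radical_component gr i Jx.
rewrite (card_Fp p_pr) quot_component_proj;
  [|exact: ring_wdegM|exact: G_ring_homog].
by rewrite ((quot_proj_eqP _ _ _).2 Iy) -raddfMn.
Qed.
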